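(* Let $H$ be a finite dimensional real or complex Hilbert space. Let $N \in \mathbb{N}$, and let $T_1, \ldots, T_k$ be a $k$-tuple of commuting contractions on $H$ that has a unitary $N$-dilation acting on a finite dimensional Hilbert space $K$, with $\dim K = m$. Then there exist $m$ points $w^i = (w^i_1, \ldots, w^i_k)$, $i = 1, \ldots, m$, on the $k$-torus $\mathbb{T}^k$, and $m$ positive operators $A_1, \ldots, A_m \in B(H)$ satisfying $\sum_{i=1}^m A_i = I_H$, such that for every polynomial $p(z_1, \ldots, z_k)$ of degree less than or equal to $N$, $$p(T_1, \ldots, T_k) = \sum_{i=1}^{m} p(w^i_1, \ldots, w^i_k) A_i.$$
   Context: A contraction is a linear operator $T$ with $\|T\| \le 1$. $\mathbb{T} = \{z \in \mathbb{C} : |z| = 1\}$. $B(H)$ is the algebra of linear operators on $H$, and $I_H$ is the identity operator on $H$; positive means positive semidefinite. Degree means total degree. A unitary $N$-dilation for commuting contractions $T_1, \ldots, T_k$ on $H$ is a $k$-tuple of commuting unitaries $U_1, \ldots, U_k$ acting on a Hilbert space $K \supseteq H$ such that $T_1^{n_1} \cdots T_k^{n_k} = P_H U_1^{n_1} \cdots U_k^{n_k} P_H$ (as operators on $H$) for all non-negative integers $n_1, \ldots, n_k$ satisfying $n_1 + \cdots + n_k \leq N$, where $P_H$ is the orthogonal projection of $K$ onto $H$.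
   Formalization: For real H the claim with A_i in B(H) fails (rotation by 90° on R², N = 1: a sum of w_i A_i that is real must be symmetric); there the A_i are positive operators on the complexification of H and p(T) is taken for the complexified tuple. *)

(* Defs.v *)
From HB Require Import structures.
From mathcomp Require Import all_boot all_order all_algebra.
From mathcomp Require Import ring.
From mathcomp Require Import reals complex mpoly.

Set Implicit Arguments.
Unset Strict Implicit.
Unset Printing Implicit Defensive.

Import Order.TTheory GRing.Theory Num.Theory.
Local Open Scope ring_scope.

Section Operators.
Variables (F : fieldType) (H : vectType F) (k : nat).

Definition commuting (T : 'I_k -> 'End(H)) :=
  forall i j, (T i \o T j = T j \o T i)%VF.

Definition power_lfun (S : 'End(H)) (n : nat) : 'End(H) :=
  iter n (comp_lfun S) \1%VF.

(* T_0^{n_0} \o ... \o T_{k-1}^{n_{k-1}}. The library's ring structure on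
   'End(H) requires H <> 0, so mmap/mmap1 are not available here. *)
Definition multi_power (T : 'I_k -> 'End(H)) (n : 'X_{1..k}) : 'End(H) :=
  \big[@comp_lfun F H H H / \1%VF]_(j < k) power_lfun (T j) (n j).

Definition mpoly_lfun (T : 'I_k -> 'End(H)) (p : {mpoly F[k]}) : 'End(H) :=
  \sum_(n <- msupp p) p@_n *: multi_power T n.

End Operators.

(* A Hilbert space is a vectType with a positive definite form
   {dot H for theta}, where theta is idfun in the real case and complex
   conjugation in the complex case; the form is linear on the left. *)
Section HilbertSpaces.
Variables (F : numFieldType) (theta : {rmorphism F -> F}).
Variables (H K : vectType F).
Variables (dH : {dot H for theta}) (dK : {dot K for theta}).

(* dH x x is the square of the norm of x. *)
Definition contraction (T : 'End(H)) := forall x, dH (T x) (T x) <= dH x x.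

Definition unitary_op (U : 'End(K)) := isometry dK dK U /\ limg U = fullv.

Definition orthogonal_projection (P : 'End(K)) (W : {vspace K}) :=
  forall x, P x \in W /\ x - P x \in orthov dK W.

(* H is viewed as a subspace of K through the isometric embedding V. *)
Definition unitary_dilation (N k : nat) (T : 'I_k -> 'End(H))
    (V : 'Hom(H, K)) (P : 'End(K)) (U : 'I_k -> 'End(K)) :=
  [/\ isometry dK dH V,
      orthogonal_projection P (limg V),
      forall j, unitary_op (U j),
      commuting U
    & forall n : 'X_{1..k}, (mdeg n <= N)%N ->
        (V \o multi_power T n = P \o multi_power U n \o P \o V)%VF].

Definition has_unitary_dilation (N k : nat) (T : 'I_k -> 'End(H)) :=
  exists V P U, unitary_dilation N T V P U.

End HilbertSpaces.

(* Over R[i], the order makes 0 <= z imply that z is real, so this is positive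
   semidefiniteness, self-adjointness included. It would not be over R. *)
Definition positive_op (R : realType) (H : vectType R[i])
    (dH : {dot H for Num.conj}) (A : 'End(H)) := forall x, 0 <= dH (A x) x.

(* The pair (x, y) stands for x + iy. *)
Definition complexification (R : realType) (H : vectType R) : Type :=
  (H * H)%type.

Section Complexification.
Variables (R : realType) (H : vectType R).
Implicit Types (z : complexification H) (a b : R[i]).

HB.instance Definition _ :=
  GRing.Zmodule.copy (complexification H) (H * H)%type.

Definition complexification_scale a z : complexification H :=
  (complex.Re a *: z.1 - complex.Im a *: z.2,
   complex.Re a *: z.2 + complex.Im a *: z.1).

Let scaleA a b z :
  complexification_scale a (complexification_scale b z) =
  complexification_scale (a * b) z.
Proof.
case: a b z => [a1 a2] [b1 b2] [x y]; rewrite /complexification_scale /=.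
rewrite !(scalerBr, scalerDr, scalerBl, scalerDl, scalerA).
congr pair; first by rewrite !opprD [- _ - _]addrC addrACA.
by rewrite [_ *: x - _ *: y]addrC addrACA.
Qed.

Let scale1 : left_id 1 complexification_scale.
Proof.
case=> x y; rewrite /complexification_scale /=.
by rewrite !scale1r !scale0r subr0 addr0.
Qed.

Let scaleDr : right_distributive complexification_scale +%R.
Proof.
case=> [a1 a2] [x y] [x' y']; congr pair;
  by rewrite /= !scalerDr ?opprD addrACA.
Qed.

Let scaleDl z : {morph complexification_scale^~ z : a b / a + b}.
Proof.
case: z => x y [a1 a2] [b1 b2]; congr pair;
  by rewrite /= !scalerDl ?opprD addrACA.
Qed.

HB.instance Definition _ :=
  GRing.Zmodule_isLmodule.Build R[i] (complexification H)
    scaleA scale1 scaleDr scaleDl.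

Import VectorInternalTheory.

Let vect_axiom : Vector.axiom (dim H) (complexification H).
Proof.
pose v2r' z : 'rV[R[i]]_(dim H) := \row_j Complex (v2r z.1 0 j) (v2r z.2 0 j).
pose r2v' (v : 'rV[R[i]]_(dim H)) : complexification H :=
  (r2v (\row_j complex.Re (v 0 j)), r2v (\row_j complex.Im (v 0 j))).
exists v2r'.
  move=> [a1 a2] z z'; apply/rowP => j.
  by rewrite !mxE /= !linearD !linearN !linearZ !mxE /= mulrN.
exists r2v' => [[x y]|v].
  by congr (_, _); rewrite -[RHS]v2rK; congr r2v; apply/rowP => j; rewrite !mxE.
by apply/rowP => j; rewrite !mxE /= !r2vK !mxE; case: (v 0 j).
Qed.

HB.instance Definition _ :=
  Lmodule_hasFinDim.Build R[i] (complexification H) vect_axiom.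

Definition complexify_fun (T : 'End(H)) z : complexification H :=
  (T z.1, T z.2).

Let complexify_fun_linear T : linear (complexify_fun T).
Proof.
move=> a z z'; congr pair; by rewrite /= !linearD ?linearN !linearZ.
Qed.

HB.instance Definition _ T :=
  GRing.isLinear.Build R[i] (complexification H) (complexification H) *:%R
    (complexify_fun T) (complexify_fun_linear T).

Definition complexify (T : 'End(H)) : 'End(complexification H) :=
  linfun (complexify_fun T).

Lemma complexifyE T z : complexify T z = (T z.1, T z.2).
Proof. by rewrite lfunE. Qed.

Variable dH : {dot H for idfun}.

(* <x + iy, x' + iy'>
     = <x, x'> + <y, y'> + i (<y, x'> - <x, y'>). *)
Definition complexify_dot z z' : R[i] :=
  Complex (dH z.1 z'.1 + dH z.2 z'.2) (dH z.2 z'.1 - dH z.1 z'.2).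

Let dHC x y : dH x y = dH y x.
Proof. by rewrite hermC mul1r. Qed.

Let dotC z z' :
  complexify_dot z z' = (-1) ^+ false * Num.conj (complexify_dot z' z).
Proof.
rewrite mul1r /complexify_dot; congr Complex.
  by congr (_ + _); apply: dHC.
by rewrite opprB; congr (_ - _); apply: dHC.
Qed.

Let dot_linearl z' : linear_for *%R (complexify_dot^~ z').
Proof.
move=> a z1 z2; case: a => a1 a2; rewrite /complexify_dot /=.
rewrite !(linearDl, linearNl, linearZl_LR) /=.
congr Complex; ring.
Qed.

Let dot_bilinear : bilinear_for
  (GRing.Scale.Law.clone _ _ *%R _)
  (GRing.Scale.Law.clone _ _ (Num.conj \; *%R) _) complexify_dot.
Proof.
split=> [z'|z]; first exact: dot_linearl.
move=> a z1 z2; rewrite dotC dot_linearl rmorphD rmorphM /=.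
by rewrite mulrDr mulrCA -!dotC.
Qed.

HB.instance Definition _ := bilinear_isBilinear.Build R[i]
  (complexification H) (complexification H) R[i]
  (GRing.Scale.Law.clone _ _ *%R _)
  (GRing.Scale.Law.clone _ _ (Num.conj \; *%R) _) complexify_dot dot_bilinear.

HB.instance Definition _ := @isHermitianSesquilinear.Build R[i]
  (complexification H) false Num.conj complexify_dot dotC.

Let dot_gt0 z : z != 0 -> 0 < complexify_dot z z.
Proof.
have ge0 x : 0 <= dH x x.
  by have [->|/neq0_dnorm_gt0/ltW//] := eqVneq x 0; rewrite linear0l.
case: z => x y nz; rewrite ltcE /= dHC subrr eqxx /=.
have [x0|x0] := eqVneq x 0; last by rewrite ltr_wpDr// neq0_dnorm_gt0.
have [y0|y0] := eqVneq y 0; last by rewrite ltr_wpDl// neq0_dnorm_gt0.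
by rewrite x0 y0 eqxx in nz.
Qed.

HB.instance Definition _ := @isDotProduct.Build R[i] (complexification H)
  complexify_dot dot_gt0.

End Complexification.

(* Main.v *)
Require Import Defs.
From HB Require Import structures.
From mathcomp Require Import all_boot all_order all_algebra.
From mathcomp Require Import reals complex mpoly.

Set Implicit Arguments.
Unset Strict Implicit.
Unset Printing Implicit Defensive.

Import Order.TTheory GRing.Theory Num.Theory.
Local Open Scope ring_scope.

(* The commuting unitaries U_j of the dilation have an orthonormal basis
   e_1, ..., e_m of joint eigenvectors: the orthogonal complement of joint
   eigenvectors is stable under isometries and, if nonzero, contains another
   one. With U_j e_i = w^i_j e_i and V : H -> K the embedding, put
   A_i x = <V x, e_i> V^* e_i; then T^n = V^* U^n V = \sum_i (w^i)^n A_i for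
   |n| <= N. In the real case the dilation is complexified first. *)

Lemma common_eigenvector_in (C : numClosedFieldType) (K : vectType C) (k : nat)
    (U : 'I_k -> 'End(K)) (W : {vspace K}) :
  commuting U -> (forall j x, x \in W -> U j x \in W) -> W != 0%VS ->
  exists v, [/\ v \in W, v != 0 & forall j, exists a, U j v = a *: v].
Proof.
move=> comU stabW W_neq0.
pose b := vbasis W; pose d := \dim W.
pose M j := \matrix_(i < d, l < d) coord b l (U j b`_i) : 'M[C]_d.
pose phi (u : 'rV[C]_d) := \sum_(i < d) u 0 i *: b`_i.
have b_mem (i : 'I_d) : b`_i \in W by rewrite vbasis_mem ?memt_nth.
have phi_mem u : phi u \in W by apply: rpred_sum => i _; rewrite rpredZ.
have phi_inj : injective phi.
  move=> u v /(congr1 (fun x => coord b ^~ x)) uv; apply/rowP => i.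
  have := congr1 (@^~ i) uv.
  by rewrite /phi !coord_sum_free ?(basis_free (vbasisP W)).
have phi0 : phi 0 = 0 by rewrite /phi big1 // => i _; rewrite mxE scale0r.
have phiZ a u : phi (a *: u) = a *: phi u.
  by rewrite /phi scaler_sumr; apply: eq_bigr => i _; rewrite mxE scalerA.
have phiM j u : phi (u *m M j) = U j (phi u).
  rewrite /phi linear_sum /=; under [RHS]eq_bigr => i _.
    rewrite linearZ /= (coord_vbasis (stabW j _ (b_mem i))) scaler_sumr.
    over.
  rewrite exchange_big /=; apply: eq_bigr => l _; rewrite mxE scaler_suml.
  by apply: eq_bigr => i _; rewrite scalerA mxE.
have comM : {in [seq M j | j : 'I_k] &, forall A B, comm_mx A B}.
  move=> _ _ /codomP[j ->] /codomP[l ->]; apply/row_matrixP => i.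
  rewrite !rowE !mulmxA; apply: phi_inj; rewrite !phiM.
  by rewrite -!comp_lfunE comU.
have d_gt0 : (0 < d)%N by rewrite lt0n dimv_eq0.
have [u u_neq0 /allP/= stab_u] := common_eigenvector d_gt0 comM.
exists (phi u); split=> // [|j].
  by apply: contra_neq u_neq0; rewrite -phi0 => /phi_inj.
have /sub_rVP[a Ma] := stab_u _ (codom_f M j).
by exists a; rewrite -phiM Ma phiZ.
Qed.

Section OrthonormalEigenvectors.
Variables (C : numClosedFieldType) (K : vectType C) (dK : {dot K for Num.conj}).

Lemma orthov_span_eq0 (s : seq K) :
  orthov dK <<s>>%VS = 0%VS -> <<s>>%VS = fullv.
Proof.
move=> s0; apply/eqP; rewrite eqEsubv subvf /=; apply/subvP => x _.
have [y ys [z [-> _ zs]]] := orthogonal_split dK s x.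
suff -> : z = 0 by rewrite addr0.
apply/eqP; rewrite -memv0 -s0; apply/mem_orthovP => t ts.
by apply: span_orthogonal zs _ ts; rewrite memv_span1.
Qed.

Lemma orthonormal_expansion m (e : m.-tuple K) x :
  orthonormal dK e -> \dim {:K} = m -> x = \sum_(i < m) dK x e`_i *: e`_i.
Proof.
move=> on_e dimK; have free_e := orthonormal_free on_e.
have basis_e : basis_of fullv e.
  by rewrite basisEfree free_e subvf size_tuple dimK /=.
rewrite {1}(coord_basis basis_e (memvf x)); apply: eq_bigr => i _.
congr (_ *: _).
have [uniq_e dot_e] := orthonormalP on_e.
have e_i (j : 'I_m) : e`_j \in (e : seq K) by rewrite mem_nth ?size_tuple.
rewrite {2}(coord_basis basis_e (memvf x)) linear_sumlz (bigD1 i) //= big1.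
  by rewrite linearZl_LR /= dot_e // eqxx mulr1 addr0.
move=> j ji; rewrite linearZl_LR /= dot_e // nth_uniq ?size_tuple //.
by rewrite (inj_eq val_inj) (negPf ji) mulr0.
Qed.

Variables (k : nat) (U : 'I_k -> 'End(K)).
Hypotheses (comU : commuting U) (isoU : forall j, isometry dK dK (U j)).

Lemma isometry_eigenvalue_norm j v a : v != 0 -> U j v = a *: v -> `|a| = 1.
Proof.
move=> v_neq0 Uv.
have : dK (a *: v) (a *: v) = dK v v by rewrite -Uv; apply: isoU.
rewrite dnormZ => /eqP; rewrite -subr_eq0 -{2}[dK v v]mul1r -mulrBl mulf_eq0.
by rewrite dnorm_eq0 (negPf v_neq0) orbF subr_eq0 sqrp_eq1 ?normr_ge0 // => /eqP.
Qed.

Lemma orthov_eigenvectors_stable (s : seq K) :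
  (forall v, v \in s -> forall j, exists a, U j v = a *: v) -> 0 \notin s ->
  forall j x, x \in orthov dK <<s>>%VS -> U j x \in orthov dK <<s>>%VS.
Proof.
move=> eig s0 j x /mem_orthovP xs; apply/mem_orthovP => y ys.
apply: (@span_orthogonal _ _ dK [:: U j x] s); rewrite ?memv_span1 //.
apply/orthoPl => v vs; have [a Uv] := eig v vs j.
have v_neq0 : v != 0 by apply: contraNneq s0 => <-.
have a_neq0 : a != 0.
  by rewrite -normr_eq0 (isometry_eigenvalue_norm v_neq0 Uv) oner_eq0.
have : dK (U j x) (a *: v) = 0.
  by rewrite -Uv -(xs v) ?memv_span //; apply: isoU.
rewrite linearZr_LR /= => /eqP.
by rewrite mulf_eq0 conjC_eq0 (negPf a_neq0) => /eqP.
Qed.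

Lemma orthonormal_eigenvectors n : (n <= \dim {:K})%N ->
  exists s : seq K, [/\ size s = n, orthonormal dK s
    & forall v, v \in s -> forall j, exists a, U j v = a *: v].
Proof.
elim: n => [_|n IHn n_lt]; first by exists [::].
have [s [size_s on_s eig_s]] := IHn (ltnW n_lt).
have stab := orthov_eigenvectors_stable eig_s (orthonormal_not0 on_s).
have W_neq0 : orthov dK <<s>>%VS != 0%VS.
  apply: contraTneq n_lt => /orthov_span_eq0 <-.
  by rewrite -leqNgt -size_s dim_span.
have [v [/mem_orthovP vs v_neq0 eig_v]] :=
  common_eigenvector_in comU stab W_neq0.
pose c := (sqrtC (dK v v))^-1.
have normv : dK (c *: v) (c *: v) = 1.
  rewrite dnormZ normfV ger0_norm ?sqrtC_ge0 ?dnorm_ge0 // exprVn sqrtCK.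
  by rewrite mulVf // dnorm_eq0.
exists (c *: v :: s); split; first by rewrite /= size_s.
  rewrite -cat1s orthonormal_cat; apply/and3P; split=> //.
    by rewrite /orthonormal /= normv eqxx.
  by apply/orthoPl => y ys; rewrite linearZl_LR /= vs ?mulr0 ?memv_span.
move=> y; rewrite inE => /predU1P[->|/eig_s//] j.
by have [a Uv] := eig_v j; exists a; rewrite linearZ /= Uv !scalerA mulrC.
Qed.

End OrthonormalEigenvectors.

Section MultiPower.
Variables (F : fieldType) (K : vectType F) (k : nat) (U : 'I_k -> 'End(K)).

Lemma multi_power0 : multi_power U 0%MM = \1%VF.
Proof.
rewrite /multi_power; elim/big_rec: _ => // j f _ ->.
by rewrite mnm0E comp_lfun1l.
Qed.

Lemma multi_power_eigenvector (w : 'I_k -> F) v (n : 'X_{1..k}) :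
  (forall j, U j v = w j *: v) ->
  multi_power U n v = (\prod_(j < k) w j ^+ n j) *: v.
Proof.
move=> eig; rewrite /multi_power.
elim/big_rec2: _ => [|j a f _ IH]; first by rewrite id_lfunE scale1r.
rewrite comp_lfunE IH linearZ /=.
have -> : power_lfun (U j) (n j) v = w j ^+ n j *: v.
  elim: (n j) => [|l IHl]; first by rewrite id_lfunE scale1r.
  by rewrite /= comp_lfunE IHl linearZ /= eig scalerA exprSr.
by rewrite scalerA mulrC.
Qed.

End MultiPower.

(* [S] is the adjoint of [V]. The case [n = 0] gives [S \o V = \1], so [V] is
   an isometric embedding. *)
Definition is_compression (F : numFieldType) (theta : {rmorphism F -> F})
    (H K : vectType F) (dH : {dot H for theta}) (dK : {dot K for theta})
    (N k : nat) (T : 'I_k -> 'End(H)) (U : 'I_k -> 'End(K))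
    (V : 'Hom(H, K)) (S : 'Hom(K, H)) :=
  [/\ commuting U, forall j, isometry dK dK (U j),
      forall y x, dH (S y) x = dK y (V x)
    & forall n : 'X_{1..k}, (mdeg n <= N)%N ->
        multi_power T n = (S \o multi_power U n \o V)%VF].

Lemma unitary_dilation_compression (F : numFieldType)
    (theta : {rmorphism F -> F}) (H K : vectType F)
    (dH : {dot H for theta}) (dK : {dot K for theta}) (N k : nat)
    (T : 'I_k -> 'End(H)) :
  has_unitary_dilation dH dK N T ->
  exists U V S, is_compression dH dK N T U V S.
Proof.
move=> [V [P [U [isoV projP unitU comU dil]]]].
have dot_eq0 (W : vectType F) (d : {dot W for theta}) x : d x x = 0 -> x = 0.
  move=> dx0; apply/eqP; apply: contra_eqT dx0 => /neq0_dnorm_gt0.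
  by move=> /(_ _ d)/gt_eqF/negbT.
have kerV : lker V = 0%VS.
  apply/eqP; rewrite -subv0; apply/subvP => x.
  rewrite memv_ker memv0 => /eqP Vx.
  by apply/eqP/(dot_eq0 _ dH); rewrite -isoV Vx linear0l.
have invV x : (V^-1)%VF (V x) = x by rewrite lker0_lfunK ?kerV.
have VinvP y : V ((V^-1)%VF (P y)) = P y.
  by rewrite limg_lfunVK; case: (projP y).
have dotP y x : dK (P y) (V x) = dK y (V x).
  have [_ /mem_orthovP/(_ _ (memv_img V (memvf x)))] := projP y.
  by rewrite linearBl /= => /eqP; rewrite subr_eq0 => /eqP.
have PV x : P (V x) = V x.
  have [PVx /mem_orthovP oVx] := projP (V x).
  apply/esym/eqP; rewrite -subr_eq0; apply/eqP/(dot_eq0 _ dK)/oVx.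
  by rewrite rpredB // memv_img ?memvf.
exists U, V, (V^-1 \o P)%VF; split=> // [j|y x|n nN].
- by case: (unitU j).
- by rewrite comp_lfunE -isoV VinvP; apply: dotP.
apply/lfunP => x; have := congr1 (fun f : 'Hom(_, _) => f x) (dil n nN).
by rewrite /= !comp_lfunE PV /= => <-; rewrite invV.
Qed.

Lemma compression_quadrature (C : numClosedFieldType) (H K : vectType C)
    (dH : {dot H for Num.conj}) (dK : {dot K for Num.conj}) (N k m : nat)
    (T : 'I_k -> 'End(H)) U V S :
  \dim {:K} = m -> is_compression dH dK N T U V S ->
  exists (w : 'I_m -> 'I_k -> C) (A : 'I_m -> 'End(H)),
    [/\ forall i j, `|w i j| = 1, forall i x, 0 <= dH (A i x) x,
        \sum_(i < m) A i = \1%VF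
      & forall p : {mpoly C[k]}, (msize p <= N.+1)%N ->
          mpoly_lfun T p = \sum_(i < m) p.@[w i] *: A i].
Proof.
move=> dimK [comU isoU adjS compr].
have [s [/eqP size_s on_s eig_s]] :=
  orthonormal_eigenvectors comU isoU (eq_leq (esym dimK)).
pose e := Tuple size_s; have [_ dot_e] := orthonormalP on_s.
have e_mem (i : 'I_m) : e`_i \in s by rewrite mem_nth ?(eqP size_s).
pose w (i : 'I_m) j := dK (U j e`_i) e`_i.
have Ue (i : 'I_m) j : U j e`_i = w i j *: e`_i.
  rewrite /w; have [a ->] := eig_s _ (e_mem i) j.
  by rewrite linearZl_LR /= dot_e ?eqxx ?mulr1.
pose A_fun (i : 'I_m) x := dK (V x) e`_i *: S e`_i.
have A_lin i : linear (A_fun i).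
  by move=> a x y; rewrite /A_fun linearP linearPl /= scalerDl scalerA.
pose A i : 'End(H) := linfun (HB.pack (A_fun i)
  (GRing.isLinear.Build _ _ _ _ _ (A_lin i)) : {linear H -> H}).
have AE i x : A i x = dK (V x) e`_i *: S e`_i by rewrite lfunE.
have monomial n : (mdeg n <= N)%N ->
    multi_power T n = \sum_(i < m) (\prod_(j < k) w i j ^+ n j) *: A i.
  move=> nN; apply/lfunP => x; rewrite compr // !comp_lfunE.
  rewrite [V x](@orthonormal_expansion _ _ dK _ e) // !linear_sum sum_lfunE.
  apply: eq_bigr => i _; rewrite !linearZ /= scale_lfunE AE.
  by rewrite (multi_power_eigenvector _ (Ue i)) linearZ /= !scalerA mulrC.
exists w, A; split.
- move=> i j; apply: (isometry_eigenvalue_norm isoU) (Ue i j).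
  by apply: contraTneq (e_mem i) => ->; apply: orthonormal_not0 on_s.
- move=> i x; rewrite AE linearZl_LR /= adjS [dK e`_i _]hermC /= mul1r.
  exact: mul_conjC_ge0.
- rewrite -(multi_power0 T) monomial ?mdeg0 //; apply: eq_bigr => i _.
  by rewrite big1 ?scale1r // => j _; rewrite mnm0E expr0.
move=> p sp; rewrite /mpoly_lfun.
under [RHS]eq_bigr => i _ do rewrite mevalE scaler_suml.
rewrite exchange_big /=; apply: eq_big_seq => n np.
rewrite monomial; last by rewrite -ltnS (leq_trans (msize_mdeg_lt np)).
by rewrite scaler_sumr; apply: eq_bigr => i _; rewrite scalerA.
Qed.

Section Complexification.
Variables (R : realType).

Lemma complexify_hom_ex (H K : vectType R) (f : 'Hom(H, K)) :
  exists g : 'Hom(complexification H, complexification K),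
    forall z, g z = (f z.1, f z.2).
Proof.
pose g_fun (z : complexification H) : complexification K := (f z.1, f z.2).
have g_lin : linear g_fun.
  by move=> a z z'; congr pair; rewrite /= !linearD ?linearN !linearZ.
exists (linfun (HB.pack g_fun (GRing.isLinear.Build _ _ _ _ _ g_lin) :
  {linear complexification H -> complexification K})).
by move=> z; rewrite lfunE.
Qed.

Lemma complexify_multi_power (H : vectType R) (k : nat) (T : 'I_k -> 'End(H))
    (n : 'X_{1..k}) (z : complexification H) :
  multi_power (fun j => complexify (T j)) n z =
  (multi_power T n z.1, multi_power T n z.2).
Proof.
have powerE j l x : power_lfun (complexify (T j)) l x =
    (power_lfun (T j) l x.1, power_lfun (T j) l x.2).
  elim: l => [|l IHl]; first by rewrite /= !id_lfunE; case: x.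
  by rewrite /= !comp_lfunE IHl complexifyE.
rewrite /multi_power; elim: (index_enum _) => [|j r IHr].
  by rewrite !big_nil !id_lfunE; case: z.
by rewrite !big_cons !comp_lfunE /= IHr powerE.
Qed.

Lemma complexify_compression (H K : vectType R)
    (dH : {dot H for idfun}) (dK : {dot K for idfun}) (N k : nat)
    (T : 'I_k -> 'End(H)) U V S :
  is_compression dH dK N T U V S ->
  exists V' S', is_compression (complexify_dot dH) (complexify_dot dK) N
    (fun j => complexify (T j)) (fun j => complexify (U j)) V' S'.
Proof.
move=> [comU isoU adjS compr].
have [V' V'E] := complexify_hom_ex V; have [S' S'E] := complexify_hom_ex S.
exists V', S'; split=> [i j|j x y|y x|n nN].
- apply/lfunP => z; rewrite !comp_lfunE !complexifyE /=.
  by rewrite -!(comp_lfunE (U _)) comU.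
- have dotU u v : dK (U j u) (U j v) = dK u v by apply: isoU.
  by rewrite /= /complexify_dot !complexifyE /= !dotU.
- by rewrite /= /complexify_dot S'E V'E /= !adjS.
apply/lfunP => z; rewrite !comp_lfunE V'E !complexify_multi_power S'E /=.
by rewrite compr // !comp_lfunE.
Qed.

End Complexification.

Theorem theorem4p7 (R : realType) (N k m : nat) :
  (* complex Hilbert spaces *)
  (forall (H K : vectType R[i])
      (dH : {dot H for Num.conj}) (dK : {dot K for Num.conj})
      (T : 'I_k -> 'End(H)),
    commuting T -> (forall j, contraction dH (T j)) ->
    \dim {:K} = m -> has_unitary_dilation dH dK N T ->
    exists (w : 'I_m -> 'I_k -> R[i]) (A : 'I_m -> 'End(H)),
      [/\ forall i j, `|w i j| = 1,
          forall i, positive_op dH (A i),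
          \sum_(i < m) A i = \1%VF
        & forall p : {mpoly R[i][k]}, (msize p <= N.+1)%N ->
            mpoly_lfun T p = \sum_(i < m) p.@[w i] *: A i])
  /\
  (* real Hilbert spaces: the operators A i act on the complexification *)
  (forall (H K : vectType R)
      (dH : {dot H for idfun}) (dK : {dot K for idfun})
      (T : 'I_k -> 'End(H)),
    commuting T -> (forall j, contraction dH (T j)) ->
    \dim {:K} = m -> has_unitary_dilation dH dK N T ->
    exists (w : 'I_m -> 'I_k -> R[i])
           (A : 'I_m -> 'End(complexification H)),
      [/\ forall i j, `|w i j| = 1,
          forall i, positive_op (complexify_dot dH) (A i),
          \sum_(i < m) A i = \1%VF
        & forall p : {mpoly R[i][k]}, (msize p <= N.+1)%N ->
            mpoly_lfun (fun j => complexify (T j)) p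
              = \sum_(i < m) p.@[w i] *: A i]).
Proof.
split=> H K dH dK T _ _ dimK /unitary_dilation_compression[U [V [S]]].
  exact: compression_quadrature.
move=> /complexify_compression[V' [S']].
by apply: compression_quadrature; move: dimK; rewrite !dimvf.
Qed.
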